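(* If a measurable subset $\Omega$ of $\mathbb{R}$ tiles $\mathbb{R}$ with a finite subset $B$ of $\mathbb{Z}$, then $\Omega$ is periodic, i.e., $\Omega+p=\Omega$ (up to Lebesgue measure zero) for some positive integer $p$.
   Context: A measurable set $\Omega\subseteq\mathbb{R}$ *tiles* $\mathbb{R}$ with a set $B\subset\mathbb{R}$ if the translates $\Omega+b$, $b\in B$, form a partition of $\mathbb{R}$ up to Lebesgue measure zero. A measurable set $\Omega\subseteq\mathbb{R}$ is *periodic* with period $p\neq0$ if $\Omega+p=\Omega$ up to Lebesgue measure zero. *)

(* Defs.v *)
From mathcomp Require Import all_boot all_order all_algebra.
From mathcomp Require Import all_classical all_reals all_analysis.
From mathcomp Require Import measurable_realfun.

Set Implicit Arguments.
Unset Strict Implicit.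
Unset Printing Implicit Defensive.

Import Order.TTheory GRing.Theory Num.Theory.
Import numFieldNormedType.Exports.

Local Open Scope classical_set_scope.
Local Open Scope ring_scope.

(* The library's default sigma-algebra on R is the Borel one; the Lebesgue
   sigma-algebra is its completion, carried by the type on which
   completed_lebesgue_measure is defined. *)
Definition lebesgue_measurable (R : realType) (A : set R) : Prop :=
  (completed_algebra_gen (@lebesgue_measure R)).-sigma.-measurable A.

Definition translate (R : realType) (A : set R) (t : R) : set R :=
  [set x + t | x in A].

Definition ae_eq_set (R : realType) (A B : set R) : Prop :=
  (@lebesgue_measure R).-negligible (A `+` B).

(* The nonemptiness of the parts of a partition is automatic here: if Omega is
   empty, then so is the union of its translates, which cannot be conull. *)
Definition tiles (R : realType) (Omega B : set R) : Prop :=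
  ae_eq_set (\bigcup_(b in B) translate Omega b) setT /\
  (forall b c : R, B b -> B c -> b != c ->
     ae_eq_set (translate Omega b `&` translate Omega c) set0).

Definition periodic_with (R : realType) (Omega : set R) (p : R) : Prop :=
  p != 0 /\ ae_eq_set (translate Omega p) Omega.

(* Main.v *)
Require Import Defs.
From mathcomp Require Import all_boot all_order all_algebra.
From mathcomp Require Import all_classical all_reals all_analysis.
From mathcomp Require Import measurable_realfun zify lra.

Import Order.TTheory GRing.Theory Num.Theory.
Import numFieldNormedType.Exports.

Local Open Scope classical_set_scope.
Local Open Scope ring_scope.

(** The translations are by integers, so the line splits into the fibres x + Z,
    and for almost every x the trace A_x = {n | x + n in Omega} tiles Z with B:
    the exceptional points of the tiling form a null set, and so do its countably
    many integer translates ([tiles_fiber]). It then suffices that every tiling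
    complement of B in Z has a period which depends on B alone, because a common
    period p of almost all the traces A_x is a period of Omega.

    That is Newman's pigeonhole argument. Let b0 be the least element of B and L
    the diameter of B. Exactly one b in B has k + b0 - b in A, so k lies in A
    iff no k - (b - b0) with b <> b0 does: the L values of A before k determine
    its value at k. The window of these L values therefore evolves
    deterministically in a set of 2 ^ L states, and a two-sided deterministic
    orbit in a set of K states has period K!, since some
    state is repeated at distance at most K no later than any given time ([deterministic_periodic]). Replacing
    the actual distance by K! is what makes the period independent of x. *)

(** * Tilings of the integers *)

(** A repetition at times i < j < i + K + 1 makes w periodic of period j - i from
    time i on, whether or not its evolution is reversible; as the orbit is
    two-sided, such an i exists no later than any prescribed time. *)
Lemma deterministic_periodic (T : finType) (w : int -> T) :
  (forall m n, w m = w n -> w (m + 1) = w (n + 1)) ->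
  forall n, w (n + (#|T| `!)%:Z) = w n.
Proof.
move=> wS n; pose K := #|T|.
have wD m k j : w m = w k -> w (m + j%:Z) = w (k + j%:Z).
  move=> mk; elim: j => [|j IH]; first by rewrite !addr0.
  by rewrite intS [1 + _]addrC !addrA; exact: wS.
(* Going back K steps makes room for K + 1 states up to time n. *)
pose u (i : 'I_K.+1) := w (n - K%:Z + i%:Z).
have /injectivePn[i [j]] : ~~ injectiveb u.
  by apply/negP => /injectiveP/leq_card; rewrite card_ord ltnn.
wlog lt_ij : i j / (i < j)%N => [th ij uij|_ uij].
  have := ij; rewrite -val_eqE neq_ltn => /orP[lt_ij|lt_ji].
    exact: th ij uij.
  by apply: (th j i) => //; rewrite eq_sym.
have per m : w (n + m%:Z + (j - i)%N%:Z) = w (n + m%:Z).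
  have := wD _ _ (K - i + m)%N uij.
  have := ltn_ord i; have := ltn_ord j => jK iK.
  have -> : n - K%:Z + i%:Z + (K - i + m)%N%:Z = n + m%:Z by lia.
  have -> : n - K%:Z + j%:Z + (K - i + m)%N%:Z = n + m%:Z + (j - i)%N%:Z by lia.
  by [].
have perq q : w (n + (q * (j - i))%N%:Z) = w n.
  elim: q => [|q IH]; first by rewrite mul0n addr0.
  by rewrite mulSn addnC PoszD addrA per.
have /dvdnP[q ->] : (j - i %| K`!)%N.
  by apply: dvdn_fact; have := ltn_ord j; lia.
exact: perq.
Qed.

(** The states are the windows of length L; the new entry of the next window is
    a value of A, which the current window determines. *)
Lemma finite_memory_periodic (L : nat) (A : int -> bool) :
  (forall m n, (forall k : nat, (0 < k <= L)%N -> A (m - k%:Z) = A (n - k%:Z)) ->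
     A m = A n) ->
  forall n, A (n + ((2 ^ L)`!)%:Z) = A n.
Proof.
move=> memA n.
pose w (n : int) := [ffun i : 'I_L => A (n - i.+1%:Z)].
have wA m k : w m = w k -> A m = A k.
  move=> mk; apply: memA => -[//|j] /= jL.
  by have /ffunP/(_ (Ordinal jL)) := mk; rewrite !ffunE.
have wS m k : w m = w k -> w (m + 1) = w (k + 1).
  move=> mk; apply/ffunP => -[i iL]; rewrite !ffunE /=.
  have -> : m + 1 - i.+1%:Z = m - i%:Z by lia.
  have -> : k + 1 - i.+1%:Z = k - i%:Z by lia.
  case: i iL => [|i] iL; first by rewrite !subr0; exact: wA.
  by have /ffunP/(_ (Ordinal (ltnW iL))) := mk; rewrite !ffunE.
have := @deterministic_periodic _ w wS n.
by rewrite card_ffun card_bool card_ord => /wA.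
Qed.

Definition tiles_int (A : int -> bool) (s : seq int) : Prop :=
  (forall n, exists2 b, b \in s & A (n - b)) /\
  (forall n b c, b \in s -> c \in s -> A (n - b) -> A (n - c) -> b = c).

(** The quantifier order is the point: the period comes before A, so that it
    serves for the traces of a tiling on all fibres simultaneously. *)
Lemma tiles_int_periodic (s : seq int) :
  exists2 p : nat, (0 < p)%N &
    forall A, tiles_int A s -> forall n, A (n + p%:Z) = A n.
Proof.
case: s => [|b1 s'].
  by exists 1%N => // A [cov _]; have [] := cov 0.
set s := b1 :: s'.
have [b0 b0s b0min] : exists2 b0, b0 \in s & forall b, b \in s -> b0 <= b.
  rewrite /s; elim: s' b1 {s} => [|a s' IH] b1.
    by exists b1; rewrite ?mem_head// => b; rewrite inE => /eqP ->.
  have [b0 b0s b0min] := IH a.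
  have [le|lt] := leP b1 b0.
    exists b1; rewrite ?mem_head// => b; rewrite in_cons => /predU1P[->//|bs].
    exact: le_trans (b0min _ bs).
  exists b0; first by rewrite in_cons b0s orbT.
  by move=> b; rewrite in_cons => /predU1P[->|/b0min//]; exact: ltW.
pose L := \max_(b <- s) `|b - b0|%N.
exists ((2 ^ L)`!) => [|A [cov disj]]; first exact: fact_gt0.
apply: finite_memory_periodic => m n mn.
(* k + b0 is covered by the copy of A translated by b0 exactly when no other
   translate covers it. Since b0 is least, the absolute value is b - b0. *)
have AE k : A k = ~~ has (fun b => (b != b0) && A (k - `|b - b0|%N%:Z)) s.
  have kE b : b \in s -> k - `|b - b0|%N%:Z = k + b0 - b.
    by move=> /b0min; lia.
  apply/idP/hasPn => [Ak b bs|noA].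
    rewrite kE//; apply/negP => /andP[/eqP bb0 Akb]; apply: bb0.
    by apply: (disj (k + b0)) => //; rewrite addrK.
  have [b bs Akb] := cov (k + b0).
  have := noA _ bs; rewrite kE// Akb andbT negbK => /eqP bb0.
  by move: Akb; rewrite bb0 addrK.
rewrite !AE; congr (~~ _); apply: eq_in_has => b bs.
have [//|bb0 /=] := eqVneq b b0; apply: mn.
rewrite absz_gt0 subr_eq0 bb0 /=.
exact: (@leq_bigmax_seq _ s xpredT (fun b => `|b - b0|%N)).
Qed.

(** * Null sets of the line *)

Lemma negligible_bigcup_countType d (T : sigmaRingType d) (R : realFieldType)
    (mu : {measure set T -> \bar R}) (I : countType) (F : I -> set T) :
  (forall i, mu.-negligible (F i)) -> mu.-negligible (\bigcup_i F i).
Proof.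
move=> F0; pose G k := if unpickle k is Some i then F i else set0.
have FG : \bigcup_i F i `<=` \bigcup_k G k.
  by move=> x [i _ Fx]; exists (pickle i); rewrite // /G pickleK.
apply: (negligibleS FG); apply: negligible_bigcup => k; rewrite /G.
by case: (unpickle k) => // ; exact: negligible_set0.
Qed.

Section LebesgueTranslation.
Context {R : realType}.
Notation mu := (@lebesgue_measure R).

(** The push-forward of Lebesgue measure by a translation gives half-open
    intervals their length, which characterizes Lebesgue measure. *)
Lemma lebesgue_measure_preimage_addr (t : R) (A : set R) : measurable A ->
  mu ((fun x => x + t) @^-1` A) = mu A.
Proof.
move=> mA; rewrite -[LHS]/(pushforward mu (fun x => x + t : measurableTypeR R) A).
apply/esym/lebesgue_measure_unique => //=.
  exact: measurable_funD.
move=> _ _ [[a b] _ <-]; rewrite /pushforward.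
have -> : (fun x => x + t) @^-1` `]a, b]%classic = `]a - t, b - t]%classic.
  by apply/seteqP; split=> x /=; rewrite !in_itv /=; lra.
rewrite !lebesgue_measure_itv /= !lte_fin ltrD2r.
by case: ifP => // _; rewrite -!EFinB; congr EFin; lra.
Qed.

Lemma negligible_preimage_addr (t : R) (N : set R) :
  mu.-negligible N -> mu.-negligible ((fun x => x + t) @^-1` N).
Proof.
move=> [A [mA A0 NA]]; exists ((fun x => x + t) @^-1` A); split.
- by rewrite -[X in measurable X]setTI; apply: measurable_funD.
- by rewrite lebesgue_measure_preimage_addr.
- by move=> x /NA.
Qed.

End LebesgueTranslation.

(** * Tilings of the line *)

Lemma translateE (R : realType) (A : set R) (t x : R) :
  translate A t x = A (x - t).
Proof.
apply/propext; split=> [[y Ay <-]|Axt]; first by rewrite addrK.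
by exists (x - t); rewrite ?subrK.
Qed.

(** N consists of the points that some integer translation moves into the set E
    where the translates of Omega fail to cover or overlap. *)
Lemma tiles_fiber (R : realType) (Omega B : set R) (s : seq int) :
  B = [set b%:~R | b in [set` s]] -> tiles Omega B ->
  exists2 N, (@lebesgue_measure R).-negligible N & forall x, ~ N x ->
    tiles_int (fun n => `[< Omega (x + n%:~R) >]) s.
Proof.
move=> BE [cov disj].
have Bs b : b \in s -> B b%:~R by move=> bs; rewrite BE; exists b.
pose U := ~` \bigcup_(b in B) translate Omega b.
(* D bc is empty unless bc is a pair of distinct elements of s, so that the
   countable union of D over all pairs of integers is still null. *)
pose D (bc : int * int) := [set x | [/\ bc.1 \in s, bc.2 \in s, bc.1 != bc.2 &
  (translate Omega bc.1%:~R `&` translate Omega bc.2%:~R) x]].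
have U0 : (@lebesgue_measure R).-negligible U.
  by move: cov; rewrite /ae_eq_set setYTC.
have D0 bc : (@lebesgue_measure R).-negligible (D bc).
  have [[bs cs bc1]|nbc] :=
      pselect [/\ bc.1 \in s, bc.2 \in s & bc.1 != bc.2].
    have := disj _ _ (Bs _ bs) (Bs _ cs).
    rewrite eqr_int => /(_ bc1); rewrite /ae_eq_set setY0.
    by apply: negligibleS => x [].
  by apply: negligibleS (negligible_set0 _) => x [? ? ? _]; apply: nbc.
pose E := U `|` \bigcup_bc D bc.
have E0 : (@lebesgue_measure R).-negligible E.
  by apply: negligibleU => //; exact: negligible_bigcup_countType.
exists (\bigcup_(n : int) ((fun x => x + n%:~R) @^-1` E)).
  apply: negligible_bigcup_countType => n; exact: negligible_preimage_addr.
move=> x Nx.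
have nE n : ~ E (x + n%:~R) by move=> En; apply: Nx; exists n.
split=> [n|n b c bs cs].
  have /contrapT[y By Oy] : ~ U (x + n%:~R) by move=> Un; apply: (nE n); left.
  move: By Oy; rewrite BE => -[b bs <-]; rewrite translateE => Ob.
  by exists b => //; apply/asboolP; rewrite rmorphB addrA.
move=> /asboolP Ob /asboolP Oc; apply/eqP/negPn/negP => bc.
apply: (nE n); right; exists (b, c) => //; split => //.
by split; rewrite translateE -addrA -rmorphB.
Qed.

Theorem theorem4p1 (R : realType) (Omega B : set R)
    (mOmega : lebesgue_measurable Omega)
    (finB : finite_set B)
    (BZ : B `<=` range (fun z : int => z%:~R : R))
    (tOB : tiles Omega B) :
  exists p : nat, (0 < p)%N /\ periodic_with Omega p%:R.
Proof.
have [s sE] : exists s : seq int, [set` s] = (fun z : int => z%:~R : R) @^-1` B.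
  have : finite_set ((fun z : int => z%:~R : R) @^-1` B).
    by apply: finite_preimage => // a b _ _ /eqP; rewrite eqr_int => /eqP.
  by move=> /finite_seqP[s ->]; exists s.
have BE : B = [set b%:~R | b in [set` s]].
  rewrite sE; apply/seteqP; split=> [x Bx|_ [b Bb <-]//].
  by have [b _ bx] := BZ _ Bx; exists b; rewrite //= bx.
have [p p0 per] := tiles_int_periodic s.
exists p; split => //; split; first by rewrite pnatr_eq0 -lt0n.
have [N N0 tileN] := tiles_fiber _ _ _ _ BE tOB.
(* Periodicity at n = - p on the fibre of x compares x - p with x. *)
apply: negligibleS N0 => x; apply: contraPP => /tileN/per/(_ (- p%:Z)).
rewrite addNr => /(congr1 is_true); rewrite !asboolE addr0 rmorphN /= -pmulrn => Op.
by case=> -[]; rewrite translateE Op.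
Qed.
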